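(* Let $\mathcal{K}=\mathbb{Q}(\sqrt{-2})$ and let $\mathcal{O}_2=\mathbb{Z}[i\sqrt{2}]$. Then the group $PU(2,1;\mathcal{O}_2)$ is generated by the elements $$I_0=\begin{bmatrix}0&0&1\\0&-1&0\\1&0&0\end{bmatrix},\quad R_1=\begin{bmatrix}1&0&0\\0&-1&0\\0&0&1\end{bmatrix},\quad R_2=\begin{bmatrix}1&2&-2\\0&-1&2\\0&0&1\end{bmatrix},$$ $$R_3=\begin{bmatrix}1&-i\sqrt{2}&-1\\0&-1&i\sqrt{2}\\0&0&1\end{bmatrix}\quad\text{and}\quad T=\begin{bmatrix}1&0&i\sqrt{2}\\0&1&0\\0&0&1\end{bmatrix}.$$
   Context: $\mathbb{C}^{2,1}$ is $\mathbb{C}^3$ with the Hermitian form $\langle \mathbf{z},\mathbf{w}\rangle=z_1\bar{w}_3+z_2\bar{w}_2+z_3\bar{w}_1$. $U(2,1)$ is the group of $3\times 3$ complex matrices preserving this form, and $PU(2,1)=U(2,1)/U(1)$, where $U(1)=\{e^{i\theta}I\}$ is the group of scalar unitary matrices. $PU(2,1;\mathcal{O})$ denotes the subgroup of $PU(2,1)$ consisting of classes of matrices in $U(2,1)$ all of whose entries lie in the ring $\mathcal{O}$. Matrices stand for their classes in $PU(2,1)$. *)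

(* Defs.v *)
From HB Require Import structures.
From mathcomp Require Import all_boot all_order all_algebra.
From mathcomp Require Import complex.
From mathcomp Require Import boolp classical_sets reals trigo.
From mathcomp Require Import ring.

Set Implicit Arguments.
Unset Strict Implicit.
Unset Printing Implicit Defensive.

Import Order.TTheory GRing.Theory Num.Theory.
Local Open Scope quotient_scope.
Local Open Scope classical_set_scope.
Local Open Scope ring_scope.

Definition generated_subgroup (G : groupType) (S : set G) : set G :=
  smallest (fun H : set G => group_closed (fun x => x \in H)) S.

Section U21.
Variable R : realType.
Local Notation C := R[i].

Definition herm (z w : 'cV[C]_3) : C :=
  z 0 0 * (w 2 0)^* + z 1 0 * (w 1 0)^* + z 2 0 * (w 0 0)^*.

Definition preserves_herm : pred 'M[C]_3 := fun A =>
  `[< forall z w : 'cV[C]_3, herm (A *m z) (A *m w) = herm z w >].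

(* Matrices act on column vectors on the left.  Invertibility is not assumed: it
   follows from the form being nondegenerate (U21_unitmx). *)
Record U21 := MkU21 { U21_mx :> 'M[C]_3 ; _ : preserves_herm U21_mx }.

HB.instance Definition _ := [isSub for U21_mx].
HB.instance Definition _ := [Choice of U21 by <:].

Lemma hermE (A : U21) (z w : 'cV[C]_3) :
  herm (U21_mx A *m z) (U21_mx A *m w) = herm z w.
Proof. by case: A => A /= /asboolP ->. Qed.

Lemma ord3P (P : 'I_3 -> Prop) : P 0 -> P 1 -> P 2 -> forall i, P i.
Proof.
move=> P0 P1 P2 [[|[|[|//]]] i3].
- by have -> : Ordinal i3 = 0 by exact: val_inj.
- by have -> : Ordinal i3 = 1 by exact: val_inj.
- by have -> : Ordinal i3 = 2 by exact: val_inj.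
Qed.

Lemma herm_nondegenerate (z : 'cV[C]_3) : (forall w, herm z w = 0) -> z = 0.
Proof.
move=> zw0; apply/matrixP => i j; rewrite (ord1 j) mxE; move: i.
apply: ord3P.
- have := zw0 (delta_mx 2 0).
  by rewrite /herm !mxE /= !conjC0 conjC1 !mulr0 !addr0 mulr1.
- have := zw0 (delta_mx 1 0).
  by rewrite /herm !mxE /= !conjC0 conjC1 !mulr0 addr0 add0r mulr1.
- have := zw0 (delta_mx 0 0).
  by rewrite /herm !mxE /= !conjC0 conjC1 !mulr0 !add0r mulr1.
Qed.

Lemma U21_unitmx (A : U21) : U21_mx A \in unitmx.
Proof.
rewrite -unitmx_tr -row_free_unit -kermx_eq0.
apply/rowV0P => v /sub_kermxP vA0.
apply: trmx_inj; rewrite trmx0; apply: herm_nondegenerate => w.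
rewrite -(hermE A); have -> : U21_mx A *m v^T = 0.
  by apply: trmx_inj; rewrite trmx_mul trmxK trmx0.
by rewrite /herm !mxE !mul0r !addr0.
Qed.

Lemma preserves_herm1 : preserves_herm 1%:M.
Proof. by apply/asboolP => z w; rewrite !mul1mx. Qed.

Lemma preserves_hermM (A B : U21) : preserves_herm (U21_mx A *m U21_mx B).
Proof. by apply/asboolP => z w; rewrite -!mulmxA !hermE. Qed.

Lemma preserves_hermV (A : U21) : preserves_herm (invmx (U21_mx A)).
Proof.
apply/asboolP => z w.
by rewrite -(hermE A) !mulmxA mulmxV ?U21_unitmx// !mul1mx.
Qed.

Definition U21_one : U21 := MkU21 preserves_herm1.
Definition U21_mul (A B : U21) : U21 := MkU21 (preserves_hermM A B).
Definition U21_inv (A : U21) : U21 := MkU21 (preserves_hermV A).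

Lemma U21_mulA : associative U21_mul.
Proof. by move=> A B D; apply: val_inj; exact: mulmxA. Qed.
Lemma U21_mul1 : left_id U21_one U21_mul.
Proof. by move=> A; apply: val_inj; exact: mul1mx. Qed.
Lemma U21_1mul : right_id U21_one U21_mul.
Proof. by move=> A; apply: val_inj; exact: mulmx1. Qed.
Lemma U21_mulV : left_inverse U21_one U21_inv U21_mul.
Proof. by move=> A; apply: val_inj; apply: mulVmx; exact: U21_unitmx. Qed.
Lemma U21_Vmul : right_inverse U21_one U21_inv U21_mul.
Proof. by move=> A; apply: val_inj; apply: mulmxV; exact: U21_unitmx. Qed.

HB.instance Definition _ :=
  isGroup.Build U21 U21_mulA U21_mul1 U21_1mul U21_mulV U21_Vmul.

Definition U1 : pred U21 := fun A =>
  `[< exists t : R, U21_mx A = (cos t +i* sin t)%C%:M >].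

Lemma U1_1 : U1 1%g.
Proof. by apply/asboolP; exists 0; rewrite cos0 sin0. Qed.

Lemma U1_M A B : U1 A -> U1 B -> U1 (A * B)%g.
Proof.
move=> /asboolP[s As] /asboolP[t Bt]; apply/asboolP; exists (s + t).
rewrite [LHS](_ : _ = U21_mx A *m U21_mx B)// As Bt -scalar_mxM cosD sinD.
congr scalar_mx; apply/eqP; rewrite eq_complex /= eqxx/=.
by rewrite addrC.
Qed.

Lemma U1_V A : U1 A -> U1 A^-1%g.
Proof.
move=> /asboolP[s As]; apply/asboolP; exists (- s).
rewrite [LHS](_ : _ = invmx (U21_mx A))//.
apply: (can_inj (mulKmx (U21_unitmx A))).
rewrite mulmxV ?U21_unitmx// As -scalar_mxM cosN sinN; congr scalar_mx.
apply/eqP; rewrite eq_complex /= !mulrN opprK -!expr2 cos2Dsin2 eqxx/=.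
by rewrite mulrC addNr.
Qed.

Lemma U1_J A B : U1 A -> U1 (B * A * B^-1)%g.
Proof.
move=> /asboolP[s As]; apply/asboolP; exists s.
rewrite [LHS](_ : _ = U21_mx B *m U21_mx A *m invmx (U21_mx B))//.
by rewrite As scalar_mxC -mulmxA mulmxV ?mulmx1 // U21_unitmx.
Qed.

(* The scalar subgroup U1 is normal (even central), so left and right cosets
   coincide. *)
Definition eqU1 : rel U21 := fun A B => U1 (A * B^-1)%g.

Lemma eqU1_refl : reflexive eqU1.
Proof. by move=> A; rewrite /eqU1 mulgV U1_1. Qed.

Lemma eqU1_sym : symmetric eqU1.
Proof.
have h A B : eqU1 A B -> eqU1 B A by move=> /U1_V; rewrite invgM invgK.
by move=> A B; apply/idP/idP; exact: h.
Qed.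

Lemma eqU1_trans : transitive eqU1.
Proof. by move=> B A D AB /(U1_M AB); rewrite mulgA mulgVK. Qed.

Canonical eqU1_equiv := EquivRel eqU1 eqU1_refl eqU1_sym eqU1_trans.

Definition PU21 := {eq_quot eqU1}.

HB.instance Definition _ := Choice.on PU21.
HB.instance Definition _ := EqQuotient.on PU21.

Definition PU21_one : PU21 := lift_cst PU21 1%g.
Definition PU21_inv : PU21 -> PU21 := lift_op1 PU21 (fun A => A^-1)%g.
Definition PU21_mul : PU21 -> PU21 -> PU21 :=
  lift_op2 PU21 (fun A B => A * B)%g.

Lemma eqU1P (A B : U21) : reflect (A = B %[mod PU21]) (eqU1 A B).
Proof. by rewrite -eqmodE; exact: eqP. Qed.

Lemma pi_inv : {morph \pi_PU21 : A / (A^-1)%g >-> PU21_inv A}.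
Proof.
move=> A; unlock PU21_inv; apply/eqU1P.
have /eqU1P : repr (\pi_PU21 A) = A %[mod PU21] by rewrite reprK.
move: (repr _) => B; rewrite eqU1_sym /eqU1 invgK => /U1_V/(U1_J A^-1)%g.
by rewrite invgM !invgK mulgA mulgVK.
Qed.

Lemma pi_mul : {morph \pi_PU21 : A B / (A * B)%g >-> PU21_mul A B}.
Proof.
move=> A B; unlock PU21_mul; apply/eqU1P.
have /eqU1P : A = repr (\pi_PU21 A) %[mod PU21] by rewrite reprK.
have /eqU1P : B = repr (\pi_PU21 B) %[mod PU21] by rewrite reprK.
move: (repr _) (repr _) => B' A' hB hA.
have := U1_M (U1_J A hB) hA.
by rewrite /eqU1 invgM !mulgA mulgVK.
Qed.

Canonical pi_inv_morph := PiMorph1 pi_inv.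
Canonical pi_mul_morph := PiMorph2 pi_mul.

Lemma PU21_mulA : associative PU21_mul.
Proof. by elim/quotW=> A; elim/quotW=> B; elim/quotW=> D; rewrite !piE mulgA. Qed.
Lemma PU21_mul1 : left_id PU21_one PU21_mul.
Proof. by elim/quotW=> A; unlock PU21_one; rewrite !piE mul1g. Qed.
Lemma PU21_1mul : right_id PU21_one PU21_mul.
Proof. by elim/quotW=> A; unlock PU21_one; rewrite !piE mulg1. Qed.
Lemma PU21_mulV : left_inverse PU21_one PU21_inv PU21_mul.
Proof. by elim/quotW=> A; unlock PU21_one; rewrite !piE mulVg. Qed.
Lemma PU21_Vmul : right_inverse PU21_one PU21_inv PU21_mul.
Proof. by elim/quotW=> A; unlock PU21_one; rewrite !piE mulgV. Qed.

HB.instance Definition _ :=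
  isGroup.Build PU21 PU21_mulA PU21_mul1 PU21_1mul PU21_mulV PU21_Vmul.

(* A class belongs to PU(2,1;O) as soon as one of its representatives in U(2,1)
   has all its entries in O. *)
Definition PU21_over (O : set C) : set PU21 :=
  [set \pi_PU21 A | A in [set A : U21 | forall i j, O (U21_mx A i j)]].

(* i * sqrt 2; Z[i sqrt 2] is the set of a + b (i sqrt 2). *)
Definition isqrt2 : C := (0 +i* Num.sqrt 2)%C.

Definition O2 : set C :=
  [set a%:~R + b%:~R * isqrt2 | a in [set: int] & b in [set: int]].

Definition mx3 (rows : seq (seq C)) : 'M[C]_3 :=
  \matrix_(i < 3, j < 3) nth 0 (nth [::] rows i) j.

Definition I0_mx := mx3 [:: [:: 0;  0; 1];
                            [:: 0; -1; 0];
                            [:: 1;  0; 0]].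

Definition R1_mx := mx3 [:: [:: 1;  0; 0];
                            [:: 0; -1; 0];
                            [:: 0;  0; 1]].

Definition R2_mx := mx3 [:: [:: 1;  2; -2];
                            [:: 0; -1;  2];
                            [:: 0;  0;  1]].

Definition R3_mx := mx3 [:: [:: 1; - isqrt2;     -1];
                            [:: 0;       -1; isqrt2];
                            [:: 0;        0;      1]].

Definition T_mx := mx3 [:: [:: 1; 0; isqrt2];
                           [:: 0; 1;      0];
                           [:: 0; 0;      1]].

Lemma conj_isqrt2 : isqrt2^* = - isqrt2.
Proof. by apply/eqP; rewrite eq_complex /= oppr0 !eqxx. Qed.

Lemma isqrt2_sqr : isqrt2 * isqrt2 = - 2.
Proof.
have -> : (2 : C) = (2 +i* 0)%C by rewrite -[2 in RHS]/(1 + 1) -[0]addr0.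
apply/eqP; rewrite eq_complex /= !mul0r mulr0 add0r addr0 oppr0 eqxx andbT.
by rewrite -expr2 sqr_sqrtr ?ler0n.
Qed.

Lemma mx3_mul rows (z : 'cV[C]_3) i :
  (mx3 rows *m z) i 0 = nth 0 (nth [::] rows i) 0 * z 0 0 +
    nth 0 (nth [::] rows i) 1 * z 1 0 + nth 0 (nth [::] rows i) 2 * z 2 0.
Proof.
rewrite mxE !big_ord_recl big_ord0 addr0 !mxE /= addrA.
by congr (_ + _ * z _ 0 + _ * z _ 0); apply: val_inj.
Qed.

Lemma I0_subproof : preserves_herm I0_mx.
Proof.
apply/asboolP => z w; rewrite /herm !mx3_mul /=.
by rewrite ?(rmorphD, rmorphM, rmorphN, rmorph0, rmorph1) /=; ring.
Qed.

Lemma R1_subproof : preserves_herm R1_mx.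
Proof.
apply/asboolP => z w; rewrite /herm !mx3_mul /=.
by rewrite ?(rmorphD, rmorphM, rmorphN, rmorph0, rmorph1) /=; ring.
Qed.

Lemma R2_subproof : preserves_herm R2_mx.
Proof.
apply/asboolP => z w; rewrite /herm !mx3_mul /=.
by rewrite ?(rmorphD, rmorphM, rmorphN, rmorph0, rmorph1, rmorph_nat) /=; ring.
Qed.

Lemma R3_subproof : preserves_herm R3_mx.
Proof.
apply/asboolP => z w; rewrite /herm !mx3_mul /=.
rewrite ?(rmorphD, rmorphM, rmorphN, rmorph0, rmorph1) /= conj_isqrt2.
by have := isqrt2_sqr; move: isqrt2 => s ss; ring: ss.
Qed.

Lemma T_subproof : preserves_herm T_mx.
Proof.
apply/asboolP => z w; rewrite /herm !mx3_mul /=.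
rewrite ?(rmorphD, rmorphM, rmorphN, rmorph0, rmorph1) /= conj_isqrt2.
by move: isqrt2 => s; ring.
Qed.

Definition I0 : U21 := MkU21 I0_subproof.
Definition R1 : U21 := MkU21 R1_subproof.
Definition R2 : U21 := MkU21 R2_subproof.
Definition R3 : U21 := MkU21 R3_subproof.
Definition T : U21 := MkU21 T_subproof.

End U21.

(* Main.v *)
Require Import Defs.
From mathcomp Require Import all_boot all_order all_algebra.
From mathcomp Require Import boolp classical_sets reals.
From mathcomp Require Import complex trigo zify ring lra.

(** Write omega for [i * sqrt 2].  Everything rests on a Euclidean-style descent
    on the lower left entry [c] of a matrix [A] with entries in Z[omega].

    The first column of [A] is a null vector.  If [c <> 0], dividing it by [c]
    gives a boundary point of complex hyperbolic space, with Heisenberg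
    coordinates [x + y omega] and [t]; as a vector it is [c] times the last
    column of the Heisenberg translation [heis x y t].  The integral translations
    are the [heis (2 m) n k]: they are products of [R2 R1], [R3 R1] and [T]
    ([generated_heis]).  Together with [R1] they bring the point into the box
    [|x| <= 1], [0 <= y <= 1/2], [|t| <= 1/2] without changing [c].  There
    [I0], which exchanges the outer coordinates, multiplies [|c|^2] by
    [q^2 + 2 t^2] with [q = (x^2 + 2 y^2) / 2].  This factor is below 1 except
    close to the corners [(1 or -1, 1/2, 1/2 or -1/2)], where it can reach
    [9/16 + 1/2 = 17/16].  All those corners are equivalent to [(1, 1/2, 1/2)]
    under integral translations, and near that point the word
    [I0 (heis 0 (-1) 1) I0] shrinks [|c|^2] by a factor about [3/16].  So some
    element of the generated group always decreases [|c|^2]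
    ([horo_reducible]).

    As [|c|^2] is a natural number, the descent reaches [c = 0].  Then [A] is
    upper triangular, and because the units of Z[omega] are 1 and -1, it is up to
    sign an integral translation, possibly times [R1] ([stabilizer_generated]).
    The sign disappears in the projective group.

    The opposite inclusion only needs that integral matrices in U(2,1) are stable
    under inversion: the inverse is the conjugate transpose read backwards
    ([invmx_herm]). *)

Local Open Scope classical_set_scope.
Local Open Scope quotient_scope.
Set Implicit Arguments.
Unset Strict Implicit.
Unset Printing Implicit Defensive.
Import Order.TTheory GRing.Theory Num.Theory.

Section Generators.
Local Open Scope ring_scope.
Variable R : realType.
Local Notation C := R[i].
Local Notation O2 := (@O2 R).


(** * Coordinates adapted to Z[i sqrt 2] *)

(** Scaling the imaginary part by [sqrt 2] turns Z[i sqrt 2] into pairs of integers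
    and every identity below into a polynomial identity between real numbers,
    without square roots. *)
Definition omc (x y : R) : C := (x +i* (y * Num.sqrt 2))%C.

Lemma sqrt2_sqr : Num.sqrt 2 * Num.sqrt 2 = 2 :> R.
Proof. by rewrite -expr2 sqr_sqrtr ?ler0n. Qed.

Lemma sqrt2_gt0 : 0 < Num.sqrt 2 :> R.
Proof. by rewrite sqrtr_gt0 ltr0n. Qed.

Lemma omcM x y x' y' :
  omc x y * omc x' y' = omc (x * x' - 2 * (y * y')) (x * y' + x' * y).
Proof.
by congr (_ +i* _)%C; have := sqrt2_sqr; move: (Num.sqrt 2) => s ss; ring: ss.
Qed.

Lemma omcD x y x' y' : omc x y + omc x' y' = omc (x + x') (y + y').
Proof. by congr (_ +i* _)%C; ring. Qed.

Lemma omcN x y : - omc x y = omc (- x) (- y).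
Proof. by congr (_ +i* _)%C; ring. Qed.

Lemma omcJ x y : (omc x y)^* = omc x (- y).
Proof. by congr (_ +i* _)%C; ring. Qed.

Lemma omc0 : 0 = omc 0 0.
Proof. by rewrite /omc mul0r. Qed.

Lemma omc1 : 1 = omc 1 0.
Proof. by rewrite /omc mul0r. Qed.

Lemma omc_isqrt2 : isqrt2 R = omc 0 1.
Proof. by rewrite /omc mul1r. Qed.

Lemma omc_nat n : n%:R = omc n%:R 0.
Proof.
elim: n => [|n IH]; first by rewrite -omc0.
by rewrite -!natr1 IH omc1 omcD addr0.
Qed.

Lemma omc_int n : n%:~R = omc n%:~R 0.
Proof. by case: n => n; rewrite ?NegzE ?mulrNz -!pmulrn omc_nat ?omcN ?oppr0. Qed.

Lemma omcP z : exists x y, z = omc x y.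
Proof.
case: z => x y; exists x, (y / Num.sqrt 2).
by rewrite /omc divfK// gt_eqF// sqrt2_gt0.
Qed.

Lemma omc_inj x y x' y' : omc x y = omc x' y' -> x = x' /\ y = y'.
Proof. by case=> -> /mulIf-> //; rewrite gt_eqF ?sqrt2_gt0. Qed.

Definition omcE := (omcM, omcD, omcN, omcJ).

Lemma O2P z : reflect (exists m n : int, z = omc m%:~R n%:~R) `[< O2 z >].
Proof.
apply: (iffP (asboolP _)) => [[m _ [n _ <-]]|[m [n ->]]]; exists m => //.
- by exists n; rewrite !omc_int omc_isqrt2 !omcE; congr omc; ring.
- by exists n => //; rewrite !omc_int omc_isqrt2 !omcE; congr omc; ring.
Qed.

Definition sqnorm (z : C) : R := complex.Re z ^+ 2 + complex.Im z ^+ 2.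

Lemma sqnormM z z' : sqnorm (z * z') = sqnorm z * sqnorm z'.
Proof. by case: z => a b; case: z' => c d; rewrite /sqnorm /=; ring. Qed.

Lemma sqnorm_omc x y : sqnorm (omc x y) = x ^+ 2 + 2 * y ^+ 2.
Proof. by rewrite /sqnorm /= exprMn sqr_sqrtr ?ler0n// [_ * 2]mulrC. Qed.

Lemma sqnorm_gt0 z : (0 < sqnorm z) = (z != 0).
Proof.
case: z => a b; rewrite /sqnorm /= eq_complex /= lt0r paddr_eq0 ?sqr_ge0//.
by rewrite !sqrf_eq0 addr_ge0 ?sqr_ge0// andbT.
Qed.

Lemma O2_omc (m n : int) : O2 (omc m%:~R n%:~R).
Proof. by apply/asboolP/O2P; exists m, n. Qed.

Lemma O2M z z' : O2 z -> O2 z' -> O2 (z * z').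
Proof.
move=> /asboolP/O2P[m [n ->]] /asboolP/O2P[m' [n' ->]]; rewrite omcM.
by rewrite (_ : 2 = 2%:~R)// -!intrM -intrB -intrD; exact: O2_omc.
Qed.

Lemma O2D z z' : O2 z -> O2 z' -> O2 (z + z').
Proof.
move=> /asboolP/O2P[m [n ->]] /asboolP/O2P[m' [n' ->]]; rewrite omcD.
by rewrite -!intrD; exact: O2_omc.
Qed.

Lemma O2J z : O2 z -> O2 z^*.
Proof.
move=> /asboolP/O2P[m [n ->]]; rewrite omcJ -intrN; exact: O2_omc.
Qed.

Lemma O2N z : O2 z -> O2 (- z).
Proof. by move=> /asboolP/O2P[m [n ->]]; rewrite omcN -!intrN; exact: O2_omc. Qed.

Lemma O2_int (m : int) : O2 (m%:~R : C).
Proof. rewrite omc_int; exact: (O2_omc _ 0). Qed.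

Lemma O2_0 : O2 (0 : C). Proof. exact: (O2_int 0). Qed.
Lemma O2_1 : O2 (1 : C). Proof. exact: (O2_int 1). Qed.
Lemma O2_2 : O2 (2 : C). Proof. exact: (O2_int 2). Qed.
Lemma O2_isqrt2 : O2 (isqrt2 R). Proof. rewrite omc_isqrt2; exact: (O2_omc 0 1). Qed.

(** * Heisenberg translations *)

(** The unipotent isometry fixing infinity whose last column is the null vector
    with horospherical coordinates [x + y (i sqrt 2)] and [t]; its real parameters
    describe boundary points as well as translations. *)
Definition heis (x y t : R) : 'M[C]_3 :=
  mx3 [:: [:: 1; - omc x (- y); omc (- (x ^+ 2 + 2 * y ^+ 2) / 2) t];
          [:: 0; 1; omc x y];
          [:: 0; 0; 1]].

Lemma mulmx3E n (A : 'M[C]_3) (B : 'M[C]_(3, n)) i j :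
  (A *m B) i j = A i 0 * B 0 j + A i 1 * B 1 j + A i 2 * B 2 j.
Proof.
rewrite mxE !big_ord_recl big_ord0 addr0 addrA.
by congr (_ + _ * B _ j + _ * B _ j); try congr (A i _); apply: val_inj.
Qed.

Lemma heisM x y t x' y' t' : heis x y t *m heis x' y' t' =
  heis (x + x') (y + y') (t + t' + y * x' - x * y').
Proof.
apply/matrixP => i j; rewrite mulmx3E !mxE; move: i j.
by apply: ord3P; apply: ord3P => /=; rewrite ?omc1 ?omc0 !omcE; congr omc; field.
Qed.

(** * Matrices in the generated group *)

Definition integral_mx (M : 'M[C]_3) := forall i j, O2 (M i j).

Definition gens : set (PU21 R) :=
  [set \pi_(PU21 R) (I0 R); \pi_(PU21 R) (R1 R); \pi_(PU21 R) (R2 R);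
       \pi_(PU21 R) (R3 R); \pi_(PU21 R) (T R)].

(** The group itself lives in PU(2,1), but the descent computes with matrices;
    this predicate forgets the proof of unitarity and works up to scalars of
    modulus 1. *)
Definition generated_mx (M : 'M[C]_3) :=
  exists2 A : U21 R, U21_mx A = M & generated_subgroup gens (\pi_(PU21 R) A).

Lemma generated_closed (G : groupType) (S : set G) :
  group_closed (fun x => x \in generated_subgroup S).
Proof.
split=> [|x y].
  by rewrite inE => H [[H1 _] _]; move: H1; rewrite inE.
rewrite !inE => Sx Sy H HS.
have [[_ HB] _] := HS; apply/set_mem/HB; apply/mem_set.
  exact: Sx.
exact: Sy.
Qed.

Lemma generatedV (G : groupType) (S : set G) x :
  generated_subgroup S x -> generated_subgroup S x^-1%g.
Proof.
move=> /mem_set Sx; apply/set_mem.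
exact: (group_closedV (generated_closed S)).
Qed.

Lemma generatedM (G : groupType) (S : set G) x y :
  generated_subgroup S x -> generated_subgroup S y ->
  generated_subgroup S (x * y)%g.
Proof.
move=> /mem_set Sx /mem_set Sy; apply/set_mem.
exact: (group_closedM (generated_closed S)).
Qed.

Lemma generated1 (G : groupType) (S : set G) : generated_subgroup S 1%g.
Proof. by apply/set_mem; case: (generated_closed S). Qed.

Lemma piM (A B : U21 R) :
  \pi_(PU21 R) (A * B)%g = (\pi_(PU21 R) A * \pi_(PU21 R) B)%g.
Proof. exact: Defs.pi_mul. Qed.

Lemma piV (A : U21 R) : \pi_(PU21 R) A^-1%g = (\pi_(PU21 R) A)^-1%g.
Proof. exact: Defs.pi_inv. Qed.

Lemma pi1 : \pi_(PU21 R) 1%g = 1%g.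
Proof. by apply: (@mulIg (PU21 R) (\pi_(PU21 R) 1%g)); rewrite -piM !mul1g. Qed.

Lemma generated_mul M N : generated_mx M -> generated_mx N ->
  generated_mx (M *m N).
Proof.
move=> [A <- GA] [B <- GB]; exists (A * B)%g => //.
by rewrite piM; exact: generatedM.
Qed.

Lemma generated_cancel M N : generated_mx M -> generated_mx (M *m N) ->
  generated_mx N.
Proof.
move=> [A <- GA] [B BE GB]; exists (A^-1 * B)%g.
  by rewrite [LHS](_ : _ = invmx A *m B)// BE mulKmx// U21_unitmx.
by rewrite piM piV; apply: generatedM => //; apply: generatedV.
Qed.

Lemma generated_cancelr M N : generated_mx N -> generated_mx (M *m N) ->
  generated_mx M.
Proof.
move=> [A <- GA] [B BE GB]; exists (B * A^-1)%g.
  by rewrite [LHS](_ : _ = B *m invmx A)// BE mulmxK// U21_unitmx.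
by rewrite piM piV; apply: generatedM => //; apply: generatedV.
Qed.

Lemma generated_gen (A : U21 R) : gens (\pi A) ->
  generated_mx (U21_mx A).
Proof. by move=> GA; exists A => //; apply: sub_gen_smallest. Qed.

Lemma generated_I0 : generated_mx (I0_mx R).
Proof. by apply: (@generated_gen (I0 R)); do 4 left. Qed.

Lemma generated_R1 : generated_mx (R1_mx R).
Proof. by apply: (@generated_gen (R1 R)); do 3 left; right. Qed.

Lemma generated_R2 : generated_mx (R2_mx R).
Proof. by apply: (@generated_gen (R2 R)); do 2 left; right. Qed.

Lemma generated_R3 : generated_mx (R3_mx R).
Proof. by apply: (@generated_gen (R3 R)); left; right. Qed.

Lemma generated_T : generated_mx (T_mx R).
Proof. by apply: (@generated_gen (T R)); right. Qed.

Lemma generated_scalar A : U1 A -> generated_mx A.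
Proof.
move=> UA; exists A => //; rewrite (_ : \pi_(PU21 R) A = 1%g).
  exact: generated1.
by rewrite -pi1; apply/eqP; rewrite eqmodE /= /eqU1 invg1 mulg1.
Qed.

Lemma generatedN1_mx : generated_mx (- 1%:M).
Proof.
have h : preserves_herm (- 1%:M : 'M[C]_3).
  by apply/asboolP => z z'; rewrite !mulNmx !mul1mx /herm !mxE !rmorphN /=; ring.
apply: (@generated_scalar (MkU21 h)); apply/asboolP; exists pi => /=.
rewrite cospi sinpi -raddfN /=.
by congr scalar_mx; apply/eqP; rewrite eq_complex /= oppr0 !eqxx.
Qed.

Lemma generatedN_mx M : generated_mx (- M) -> generated_mx M.
Proof.
by move=> GM; apply: (generated_cancel generatedN1_mx); rewrite mulNmx mul1mx.
Qed.

(** * Integral matrices form a group *)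

Lemma integral_mul M N : integral_mx M -> integral_mx N -> integral_mx (M *m N).
Proof.
by move=> OM ON i j; rewrite mulmx3E; do ?apply: O2D; apply: O2M.
Qed.

Lemma integral_mx3 rows :
  (forall i j : 'I_3, O2 (nth 0 (nth [::] rows i) j)) -> integral_mx (mx3 rows).
Proof. by move=> h i j; rewrite mxE; exact: h. Qed.

Ltac solve_integral := apply: integral_mx3; apply: ord3P; apply: ord3P;
  rewrite /=; do ?apply: O2N;
  by [exact: O2_0|exact: O2_1|exact: O2_2|exact: O2_isqrt2].

Lemma integral_1 : integral_mx 1%:M.
Proof.
move=> i j; rewrite mxE; case: (i == j); [exact: O2_1|exact: O2_0].
Qed.

Lemma integral_I0 : integral_mx (I0_mx R).
Proof. solve_integral. Qed.

Lemma integral_R1 : integral_mx (R1_mx R).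
Proof. solve_integral. Qed.

Lemma integral_R2 : integral_mx (R2_mx R).
Proof. solve_integral. Qed.

Lemma integral_R3 : integral_mx (R3_mx R).
Proof. solve_integral. Qed.

Lemma integral_T : integral_mx (T_mx R).
Proof. solve_integral. Qed.

Lemma herm_col (M : 'M[C]_3) i j : preserves_herm M ->
  herm (col i M) (col j M) = herm (delta_mx i 0) (delta_mx j 0).
Proof. by move=> /asboolP h; rewrite !colE h. Qed.

(** Preserving a form with Gram matrix [J] means [A^* J A = J], and here [J]
    reverses the order of the basis, so [A^-1 = J A^* J]. *)
Lemma invmx_herm (A : U21 R) i j :
  invmx A i j = (U21_mx A (rev_ord j) (rev_ord i))^*.
Proof.
set B := \matrix_(i, j) (U21_mx A (rev_ord j) (rev_ord i))^*.
suff BA : B *m A = 1%:M.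
  by rewrite -[invmx A]mul1mx -BA mulmxK ?U21_unitmx// mxE.
apply/matrixP => k l.
have hA : preserves_herm A by case: A {B}.
have := herm_col l (rev_ord k) hA; rewrite mulmx3E /herm !mxE.
have e0 : rev_ord 0 = 2 :> 'I_3 by exact: val_inj.
have e1 : rev_ord 1 = 1 :> 'I_3 by exact: val_inj.
have e2 : rev_ord 2 = 0 :> 'I_3 by exact: val_inj.
rewrite e0 e1 e2 => h.
transitivity (U21_mx A 0 l * (U21_mx A 2 (rev_ord k))^* +
  U21_mx A 1 l * (U21_mx A 1 (rev_ord k))^* +
  U21_mx A 2 l * (U21_mx A 0 (rev_ord k))^*); first by ring.
rewrite h; move: k l {h}; apply: ord3P; apply: ord3P; rewrite ?e0 ?e1 ?e2 /=.
all: by rewrite ?conjC0 ?conjC1; ring.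
Qed.

Lemma integral_inv (A : U21 R) : integral_mx A -> integral_mx (invmx A).
Proof. by move=> OA i j; rewrite invmx_herm; apply: O2J. Qed.

Lemma generated_sub_integral : generated_subgroup gens `<=` PU21_over O2.
Proof.
apply: smallest_sub => [|x].
  split=> [|x y]; rewrite !inE.
    by exists 1%g; [exact: integral_1|exact: pi1].
  move=> [A OA <-] [B OB <-]; exists (A * B^-1)%g; last by rewrite piM piV.
  by apply: (integral_mul OA); apply: integral_inv.
move=> [[[[|]|]|]|] ->; eexists; try reflexivity.
- exact: integral_I0.
- exact: integral_R1.
- exact: integral_R2.
- exact: integral_R3.
- exact: integral_T.
Qed.

(** * Integral Heisenberg translations *)

(** A descent step has to stay in the generated group and to keep the entries
    integral. *)
Definition available (M : 'M[C]_3) := generated_mx M /\ integral_mx M.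

Lemma availableM M N : available M -> available N -> available (M *m N).
Proof.
by move=> [GM OM] [GN ON]; split; [exact: generated_mul|exact: integral_mul].
Qed.

Lemma available_I0 : available (I0_mx R).
Proof. by split; [exact: generated_I0|exact: integral_I0]. Qed.

Lemma available_R1 : available (R1_mx R).
Proof. by split; [exact: generated_R1|exact: integral_R1]. Qed.

Lemma R1_heis x y t : R1_mx R *m heis x y t *m R1_mx R = heis (- x) (- y) t.
Proof.
apply/matrixP => i j; rewrite !mulmx3E !mxE; move: i j.
by apply: ord3P; apply: ord3P => /=; rewrite ?omc1 ?omc0 !omcE; congr omc; field.
Qed.

Lemma R2R1 : R2_mx R *m R1_mx R = heis 2 0 0.
Proof.
apply/matrixP => i j; rewrite !mulmx3E !mxE; move: i j.
by apply: ord3P; apply: ord3P => /=; rewrite ?(omc_nat 2) ?omc1 ?omc0 !omcE;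
  congr omc; field.
Qed.

Lemma R3R1 : R3_mx R *m R1_mx R = heis 0 1 0.
Proof.
apply/matrixP => i j; rewrite !mulmx3E !mxE; move: i j.
by apply: ord3P; apply: ord3P => /=; rewrite ?omc_isqrt2 ?omc1 ?omc0 !omcE;
  congr omc; field.
Qed.

Lemma T_heis : T_mx R = heis 0 0 1.
Proof.
apply/matrixP => i j; rewrite !mxE; move: i j.
by apply: ord3P; apply: ord3P => /=; rewrite ?omc_isqrt2 ?omc1 ?omc0 ?omcE;
  congr omc; field.
Qed.

Lemma heis0 : heis 0 0 0 = 1%:M.
Proof.
apply/matrixP => i j; rewrite !mxE; move: i j.
by apply: ord3P; apply: ord3P => /=;
  rewrite ?mulr0n ?mulr1n ?omc1 ?omc0 ?omcE; congr omc; field.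
Qed.

Lemma int_shift_ind (P : int -> Prop) :
  P 0 -> (forall n, P n <-> P (n + 1)) -> forall n, P n.
Proof.
move=> P0 PS; elim/int_rect => [//|n IH|n IH].
  by rewrite -addn1 PoszD -PS.
by rewrite PS (_ : - n.+1%:Z + 1 = - n%:Z)// -addn1 PoszD opprD addrNK.
Qed.

Lemma generated_heis_shift x y t a b s : generated_mx (heis x y t) ->
  generated_mx (heis a b s) <->
  generated_mx (heis x y t *m heis a b s).
Proof.
by move=> GN; split=> [|h]; [exact: generated_mul|exact: (generated_cancel GN)].
Qed.

(** The first parameter has to be even: the upper right entry has real part
    [- (x^2 + 2 y^2) / 2], which is an integer only then.  Left multiplication by
    the translations along [x] and [y] moves one parameter at a time, up to a
    change of [t], and [T] adjusts [t] freely. *)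
Lemma generated_heis (m n k : int) :
  generated_mx (heis (2 * m%:~R) n%:~R k%:~R).
Proof.
have GX : generated_mx (heis 2 0 0).
  by rewrite -R2R1; exact: generated_mul generated_R2 generated_R1.
have GY : generated_mx (heis 0 1 0).
  by rewrite -R3R1; exact: generated_mul generated_R3 generated_R1.
have GT : generated_mx (heis 0 0 1) by rewrite -T_heis; exact: generated_T.
move: m n k; elim/int_shift_ind => [|m].
  elim/int_shift_ind => [|n].
    elim/int_shift_ind => [|k].
      rewrite mulr0 heis0 -[1%:M]/(U21_mx 1%g); exists 1%g => //.
      by rewrite pi1; exact: generated1.
    rewrite (generated_heis_shift _ _ _ GT) heisM intrD.
    rewrite (_ : heis _ _ _ = heis (2 * 0%:~R) 0%:~R (k%:~R + 1)) //.
    by congr heis; ring.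
  suff e k : generated_mx (heis (2 * 0%:~R) n%:~R k%:~R) <->
             generated_mx (heis (2 * 0%:~R) (n + 1)%:~R k%:~R).
    by split=> h k; apply/e.
  rewrite (generated_heis_shift _ _ _ GY) heisM intrD.
  rewrite (_ : heis _ _ _ = heis (2 * 0%:~R) (n%:~R + 1) k%:~R) //.
  by congr heis; ring.
have e n k : generated_mx (heis (2 * m%:~R) n%:~R k%:~R) <->
             generated_mx (heis (2 * (m + 1)%:~R) n%:~R (k - 2 * n)%:~R).
  rewrite (generated_heis_shift _ _ _ GX) heisM intrD intrB intrM.
  rewrite (_ : heis _ _ _ =
    heis (2 * (m%:~R + 1)) n%:~R (k%:~R - 2 * n%:~R)) //.
  by congr heis; ring.
split=> h n k.
  by have := h n (k + 2 * n); rewrite e addrK.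
by rewrite e.
Qed.

Lemma integral_heis (m n k : int) :
  integral_mx (heis (2 * m%:~R) n%:~R k%:~R).
Proof.
have O2b : O2 (omc (2 * m%:~R) n%:~R) by rewrite -(intrM _ 2); exact: O2_omc.
apply: integral_mx3; apply: ord3P; apply: ord3P => /=;
  try exact: O2_0; try exact: O2_1.
- by apply: O2N; rewrite -omcJ; apply: O2J.
- rewrite [X in omc X](_ : _ = (- (2 * m ^+ 2 + n ^+ 2))%:~R).
    exact: O2_omc.
  by rewrite !(intrN, intrD, intrM, rmorphXn) /=; field.
- exact: O2b.
Qed.

Lemma available_heis (m n k : int) :
  available (heis (2 * m%:~R) n%:~R k%:~R).
Proof. by split; [exact: generated_heis|exact: integral_heis]. Qed.

(** * Descent on the last coordinate of a null vector *)

Definition horo c x y t : 'cV[C]_3 := c *: col 2 (heis x y t).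

Lemma heis_horo a b s c x y t :
  heis a b s *m horo c x y t = horo c (a + x) (b + y) (s + t + b * x - a * y).
Proof. by rewrite /horo -scalemxAr !colE mulmxA heisM. Qed.

Lemma R1_horo c x y t : R1_mx R *m horo c x y t = horo c (- x) (- y) t.
Proof.
rewrite /horo -R1_heis -scalemxAr !colE -!mulmxA; congr (_ *: (_ *m (_ *m _))).
apply/matrixP => i j; rewrite !mulmx3E !mxE; move: i.
by apply: ord3P => /=; ring.
Qed.

Lemma sqnorm_horo c x y t : sqnorm (horo c x y t 2 0) = sqnorm c.
Proof. by rewrite !mxE /= mulr1. Qed.

Definition reducible (v : 'cV[C]_3) :=
  exists2 B, available B & sqnorm ((B *m v) 2 0) < sqnorm (v 2 0).

Lemma reducible_act B v : available B ->
  sqnorm ((B *m v) 2 0) = sqnorm (v 2 0) ->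
  reducible (B *m v) -> reducible v.
Proof.
move=> GB e [D GD lt]; exists (D *m B); first exact: availableM.
by rewrite -mulmxA -e.
Qed.

(** [I0] moves the first coordinate, [c * (- q + t i sqrt 2)] with
    [q = (x^2 + 2 y^2) / 2], to the last place. *)
Lemma I0_reducible c x y t : c != 0 ->
  ((x ^+ 2 + 2 * y ^+ 2) / 2) ^+ 2 + 2 * t ^+ 2 < 1 -> reducible (horo c x y t).
Proof.
rewrite -sqnorm_gt0 => c0 lt1; exists (I0_mx R); first exact: available_I0.
rewrite sqnorm_horo mulmx3E !mxE /= !mul0r mul1r !addr0 sqnormM sqnorm_omc.
by rewrite mulNr sqrrN gtr_pMr.
Qed.

(** The last row of [I0 (heis 0 (-1) 1) I0] is [(-1 + omega, omega, 1)] with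
    [omega = i sqrt 2]; for [c = 1] the square norm of its product with the
    null vector is the left side of the inequality, which equals [3/16] at
    [x = 1, y = t = 1/2].  Up to sign, that row is the Hermitian product
    with the null vector [(-1, omega, 1 + omega)], chosen for this small
    value at the corner.  The word is found by descent on that vector: [I0] gives
    it a unit as last coordinate, so one more translation and [I0] send it to
    the first basis vector up to sign. *)
Lemma corner_reducible c x y t (q := (x ^+ 2 + 2 * y ^+ 2) / 2) : c != 0 ->
  (q - 2 * t - 2 * y + 1) ^+ 2 + 2 * (x - q - t) ^+ 2 < 1 ->
  reducible (horo c x y t).
Proof.
rewrite -sqnorm_gt0 => c0 lt1.
exists (I0_mx R *m heis (2 * 0%:~R) (-1)%:~R 1%:~R *m I0_mx R).
  exact: availableM (availableM available_I0 (available_heis _ _ _)) available_I0.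
rewrite sqnorm_horo !mulmx3E !mxE /=.
rewrite (_ : sqnorm _ = sqnorm c *
  ((q - 2 * t - 2 * y + 1) ^+ 2 + 2 * (x - q - t) ^+ 2)).
  by rewrite gtr_pMr.
rewrite -(sqnorm_omc (q - 2 * t - 2 * y + 1) (x - q - t)) -sqnormM; congr sqnorm.
have [a [b ->]] := omcP c.
by rewrite ?omc1 ?omc0 !omcE; congr omc; rewrite /q; field.
Qed.

Lemma sqnorm_box (a b : R) : - (7 / 10) <= a <= 1 / 10 -> - (9 / 20) <= b <= 0 ->
  a ^+ 2 + 2 * b ^+ 2 < 1.
Proof. by move=> /andP[? ?] /andP[? ?]; nra. Qed.

(** The range of [t] extends further above 1/2 than below because translating
    from [x = -1] to [x = 1] adds [- 2 y] to [t], up to an integer. *)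
Lemma near_corner_reducible c x y t : c != 0 ->
  47 / 50 <= x <= 53 / 50 -> 11 / 25 <= y <= 1 / 2 -> 23 / 50 <= t <= 33 / 50 ->
  reducible (horo c x y t).
Proof.
move=> c0 /andP[x1 x2] /andP[y1 y2] /andP[t1 t2].
apply: corner_reducible => //.
by apply: sqnorm_box; apply/andP; split; nra.
Qed.

Lemma abs_cases (z : R) (a b : R) : 0 <= a -> a ^+ 2 <= z ^+ 2 -> `|z| <= b ->
   a <= z <= b \/ - b <= z <= - a.
Proof.
move=> a0 az; rewrite ler_norml => /andP[zb zb'].
have [z0|z0] := leP 0 z; [left|right]; apply/andP; split => //.
  by nra.
by nra.
Qed.

(** If [I0] fails then [q^2 >= 1/2] and [2 t^2 >= 7/16], because
    [q <= 3/4] and [2 t^2 <= 1/2] in the box.  This leaves four small regions, one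
    for each choice of the signs of [x] and [t], and an integral translation
    takes each of them to the neighbourhood of [(1, 1/2, 1/2)].  The fractions in
    the proof are rational bounds slightly weaker than the resulting square
    roots. *)
Lemma box_reducible c x y t : c != 0 ->
  `|x| <= 1 -> 0 <= y <= 1 / 2 -> `|t| <= 1 / 2 -> reducible (horo c x y t).
Proof.
move=> c0 x1 /andP[y0 y1] t1.
set q := (x ^+ 2 + 2 * y ^+ 2) / 2.
have [lt1|ge1] := ltP (q ^+ 2 + 2 * t ^+ 2) 1; first exact: I0_reducible.
have xx : x ^+ 2 <= 1 by rewrite -(real_normK (num_real x)) expr_le1.
have yy : y ^+ 2 <= 1 / 4 by nra.
have tt : t ^+ 2 <= 1 / 4.
  by rewrite -(real_normK (num_real t)); have := normr_ge0 t; nra.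
have q0 : 0 <= q by rewrite /q; nra.
have q1 : q <= 3 / 4 by rewrite /q; lra.
have q2 : 7 / 10 <= q by nra.
have ty : (11 / 25) <= y by rewrite /q in q2; nra.
have [xp|xn] : 47 / 50 <= x <= 1 \/ - 1 <= x <= - (47 / 50).
- by apply: abs_cases => //; [lra|rewrite /q in q2; lra].
- have [tp|tn] : 23 / 50 <= t <= 1 / 2 \/ - (1 / 2) <= t <= - (23 / 50).
  + by apply: abs_cases => //; [lra|nra].
  + by apply: near_corner_reducible => //; lra.
  + apply: (reducible_act (available_heis 0 0 1)); rewrite heis_horo ?sqnorm_horo//.
    by apply: near_corner_reducible => //; lra.
- have [tp|tn] : 23 / 50 <= t <= 1 / 2 \/ - (1 / 2) <= t <= - (23 / 50).
  + by apply: abs_cases => //; [lra|nra].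
  + apply: (reducible_act (available_heis 1 0 1)); rewrite heis_horo ?sqnorm_horo//.
    by apply: near_corner_reducible => //; lra.
  + apply: (reducible_act (available_heis 1 0 2)); rewrite heis_horo ?sqnorm_horo//.
    by apply: near_corner_reducible => //; lra.
Qed.

Lemma round_int (x : R) : exists m : int, `|m%:~R + x| <= 1 / 2.
Proof.
exists (- Num.floor (x + 1 / 2)); rewrite intrN ler_norml.
by have := floor_itv (x + 1 / 2); rewrite intrD; lra.
Qed.

(** Rounding [x] to an even integer, then [y] and [t] to integers, and using [R1]
    for the sign of [y], brings the point into the box. *)
Lemma horo_reducible c x y t : c != 0 -> reducible (horo c x y t).
Proof.
move=> c0.
have [m hm] := round_int (x / 2); have [n hn] := round_int y.
have [k hk] := round_int (t + n%:~R * x - 2 * m%:~R * y).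
apply: (reducible_act (available_heis m n k)); rewrite heis_horo ?sqnorm_horo//.
rewrite -2!addrA (addrA t).
move: hm hn hk.
set x' := 2 * m%:~R + x; set y' := _ + y; set t' := k%:~R + _ => hm hn ht.
have hx : `|x'| <= 1.
  by move: hm; rewrite !ler_norml /x'; lra.
have [y0|y0] := leP 0 y'.
  by apply: box_reducible; rewrite ?y0//; move: hn; rewrite ler_norml; lra.
apply: (reducible_act available_R1); rewrite R1_horo ?sqnorm_horo//.
apply: box_reducible; rewrite ?normrN//.
by move: hn; rewrite ler_norml; lra.
Qed.

(** For a vector [(z1, z2, 1)], nullity determines the real part of [z1] from
    [z2]; the imaginary part of [z1] is the free parameter [t]. *)
Lemma null_horo (v : 'cV[C]_3) : herm v v = 0 -> v 2 0 != 0 ->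
  exists x y t, v = horo (v 2 0) x y t.
Proof.
move=> v0 c0; have [x [y bE]] := omcP (v 1 0 / v 2 0).
have [p [t aE]] := omcP (v 0 0 / v 2 0).
have b_eq : v 1 0 = v 2 0 * omc x y by rewrite -bE mulrC divfK.
have a_eq : v 0 0 = v 2 0 * omc p t by rewrite -aE mulrC divfK.
have pE : p = - (x ^+ 2 + 2 * y ^+ 2) / 2.
  move: v0; rewrite /herm b_eq a_eq !rmorphM /= => v0.
  have : v 2 0 * (v 2 0)^* * (omc p t + omc x y * (omc x y)^* + (omc p t)^*) = 0.
    by rewrite -[RHS]v0; ring.
  move/eqP; rewrite !mulf_eq0 conjC_eq0 (negPf c0) /= => /eqP.
  rewrite !omcE omc0 => /omc_inj[h _]; lra.
exists x, y, t; apply/matrixP => i j; rewrite ord1 !mxE; move: i.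
by apply: ord3P; rewrite /= ?a_eq ?b_eq ?pE ?mulr1.
Qed.

(** * The stabilizer of infinity *)

Lemma sqnorm_O2 z : O2 z -> exists k : nat, sqnorm z = k%:R.
Proof.
move=> /asboolP/O2P[m [n ->]]; exists (`|m| ^ 2 + 2 * `|n| ^ 2)%N.
rewrite sqnorm_omc natrD natrM !natrX !natr_absz !intr_norm.
by rewrite !real_normK ?num_real.
Qed.

Lemma O2_unit z z' : O2 z -> O2 z' -> z * z' = 1 -> z = 1 \/ z = -1.
Proof.
move=> Oz Oz' zz'; have [k kE] := sqnorm_O2 Oz; have [k' k'E] := sqnorm_O2 Oz'.
have : (k * k' == 1)%N.
  rewrite -(eqr_nat R) natrM -kE -k'E -sqnormM zz' omc1 sqnorm_omc.
  by apply/eqP; ring.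
rewrite muln_eq1 => /andP[/eqP k1 _]; rewrite {k}k1 in kE.
move: Oz kE => /asboolP/O2P[m [n zE]]; rewrite zE sqnorm_omc => e.
have {e} : m ^+ 2 + 2 * n ^+ 2 = 1.
  by apply/eqP; rewrite -(eqr_int R) !(intrD, intrM, rmorphXn) /= e.
have [->|n0] := eqVneq n 0; last first.
  have : 1 <= n ^+ 2 by rewrite -gtz0_ge1 exprn_even_gt0.
  by have := sqr_ge0 m; lia.
rewrite expr0n mulr0 addr0 => /eqP; rewrite sqrf_eq1 => /orP[]/eqP->.
  by left; rewrite omc1.
by right; rewrite omc1 omcN oppr0.
Qed.

Lemma preserves_hermMx (M N : 'M[C]_3) :
  preserves_herm M -> preserves_herm N -> preserves_herm (M *m N).
Proof.
by move=> /asboolP hM /asboolP hN; apply/asboolP => z z'; rewrite -!mulmxA hM hN.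
Qed.

Lemma preserves_hermN (M : 'M[C]_3) : preserves_herm M -> preserves_herm (- M).
Proof.
move=> /asboolP hM; apply/asboolP => z z'; rewrite -(hM z z') !mulNmx /herm !mxE.
by rewrite !rmorphN /=; ring.
Qed.

(** Orthogonality of the columns makes [M] a Heisenberg translation
    [heis m n k] with [m] and [n] integers, and integrality of the upper right
    entry then forces [m] to be even. *)
Lemma unipotent_generated (M : 'M[C]_3) : integral_mx M -> preserves_herm M ->
  M 2 0 = 0 -> M 2 2 = 1 -> M 1 1 = 1 -> generated_mx M.
Proof.
move=> OM hM M20 M22 M11.
have := herm_col 0 0 hM; have := herm_col 0 1 hM; have := herm_col 0 2 hM.
have := herm_col 1 2 hM; have := herm_col 2 2 hM.
rewrite /herm !mxE M20 M22 M11 /=.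
rewrite !(conjC0, conjC1, mulr0, mul0r, addr0, add0r, mulr1, mul1r).
move=> h22 h12 h02 h01 /eqP; rewrite mulf_eq0 conjC_eq0 orbb => /eqP M10.
move: h01 h02; rewrite M10 !mul0r !addr0 => h01 M00.
move: h01; rewrite M00 mul1r => /eqP; rewrite conjC_eq0 => /eqP M21.
have /asboolP/O2P[m [n M12]] := OM 1 2.
have /asboolP/O2P[a [k M02]] := OM 0 2.
move: h22 h12; rewrite M12 M02 !omcE => h22 h12.
have am : 2 * a + m ^+ 2 + 2 * n ^+ 2 = 0.
  move: h22; rewrite [RHS]omc0 => /omc_inj[h _].
  by apply: (@intr_inj R); rewrite !(intrD, intrM, rmorphXn) /=; lra.
have M01 : M 0 1 = - omc m%:~R (- n%:~R).
  by apply/eqP; rewrite -addr_eq0 -h12 M21 mul0r addr0.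
have [m' mE] : exists m', m = 2 * m'.
  have [|] : m = 2 * (m %/ 2)%Z \/ m = 2 * (m %/ 2)%Z + 1 by lia.
    by exists (m %/ 2)%Z.
  by move: am => /[swap] ->; lia.
suff -> : M = heis (2 * m'%:~R) n%:~R k%:~R by exact: generated_heis.
apply/matrixP => i j; rewrite mxE; move: i j.
apply: ord3P; apply: ord3P;
  rewrite /= ?M00 ?M10 ?M20 ?M01 ?M11 ?M21 ?M02 ?M12 ?M22 //.
- by rewrite mE intrM.
- congr omc; move/(congr1 (fun z : int => z%:~R : R)): am.
  by rewrite mE !(intrD, intrM, rmorphXn) /=; lra.
- by rewrite mE intrM.
Qed.

(** The Gram matrix relations between the columns turn the vanishing of one entry
    into upper triangular shape with units of Z[i sqrt 2], so 1 or -1, on the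
    diagonal. *)
Lemma stabilizer_generated (M : 'M[C]_3) : integral_mx M -> preserves_herm M ->
  M 2 0 = 0 -> generated_mx M.
Proof.
move=> OM hM M20.
have hR1 : preserves_herm (R1_mx R) by exact: R1_subproof.
have := herm_col 0 0 hM; have := herm_col 0 1 hM; have := herm_col 0 2 hM.
have := herm_col 1 1 hM.
rewrite /herm !mxE M20 /=.
rewrite !(conjC0, conjC1, mulr0, mul0r, addr0, add0r, mulr1, mul1r).
move=> h11 h02 h01 /eqP; rewrite mulf_eq0 conjC_eq0 orbb => /eqP M10.
move: h01 h02; rewrite M10 !mul0r !addr0 => h01 h02.
have M21 : M 2 1 = 0.
  apply/eqP; rewrite -conjC_eq0; apply/eqP.
  by rewrite -[LHS]mul1r -h02 mulrAC h01 mul0r.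
rewrite M21 conjC0 mulr0 mul0r addr0 add0r in h11.
have u22 : M 2 2 = 1 \/ M 2 2 = -1.
  rewrite mulrC in h02.
  have [] := O2_unit (O2J (OM 2 2)) (OM 0 0) h02.
  + by move/(congr1 Num.conj); rewrite conjCK conjC1; left.
  + by move/(congr1 Num.conj); rewrite conjCK rmorphN1; right.
have {h11} u11 : M 1 1 = 1 \/ M 1 1 = -1 by exact: O2_unit (O2J (OM 1 1)) h11.
(* Up to sign the outer diagonal entries are 1; right multiplication by R1 then
   adjusts the middle one. *)
wlog M22 : M OM hM M20 M21 u11 u22 {M10 h01 h02} / M 2 2 = 1.
  move=> th; case: (u22) => [|M22]; first exact: th.
  apply: generatedN_mx; apply: th; rewrite ?mxE ?M20 ?M21 ?M22 ?oppr0 ?opprK //.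
  - by move=> i j; rewrite mxE; apply: O2N.
  - exact: preserves_hermN.
  - by case: u11 => ->; rewrite ?opprK; [right|left].
  - by left.
case: u11 => M11; first exact: unipotent_generated.
apply: (generated_cancelr generated_R1); apply: unipotent_generated.
- exact: integral_mul OM integral_R1.
- exact: preserves_hermMx.
- by rewrite mulmx3E !mxE /= M20 M21; ring.
- by rewrite mulmx3E !mxE /= M22 M20 M21; ring.
- by rewrite mulmx3E !mxE /= M11; ring.
Qed.

(** * Generation *)

(** Induction on a bound of the square norm of the lower left entry, which is a
    natural number, so that each descent step lowers the bound by at least 1. *)
Lemma integral_generated (A : U21 R) : integral_mx A -> generated_mx A.
Proof.
have [n] : exists n : nat, sqnorm (U21_mx A 2 0) < n%:R.
  exists (Num.bound (sqnorm (U21_mx A 2 0))).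
  by rewrite archi_boundP// addr_ge0 ?sqr_ge0.
elim: n A => [|n IH] A; first by rewrite ltNge addr_ge0 ?sqr_ge0.
move=> An OA; have hA : preserves_herm A by case: (A).
have [A20|A20] := eqVneq (U21_mx A 2 0) 0; first exact: stabilizer_generated.
have [] : reducible (col 0 A).
  have null : herm (col 0 A) (col 0 A) = 0.
    by rewrite (herm_col _ _ hA) /herm !mxE /= !(mulr0, mul0r, conjC0, addr0).
  have c0 : col 0 A 2 0 != 0 by rewrite mxE.
  by have [x [y [t ->]]] := null_horo null c0; exact: horo_reducible.
move=> M [GM OM]; have [B BM _] := GM.
rewrite (_ : M *m col 0 A = col 0 (M *m A)) ?[col 0 _ 2 0]mxE => [lt|].
2: by rewrite !colE mulmxA.
apply: (generated_cancel GM); rewrite -BM -[_ *m _]/(U21_mx (B * A)%g).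
have [k kE] := sqnorm_O2 (OA 2 0).
have OBA : integral_mx (B * A)%g.
  by rewrite [U21_mx _](_ : _ = B *m A)// BM; exact: integral_mul.
apply: IH => //.
have [l lE] := sqnorm_O2 (OBA 2 0).
move: lt An; rewrite -BM -[_ *m _]/(U21_mx (B * A)%g) kE lE !ltr_nat ltnS.
exact: leq_trans.
Qed.

End Generators.

Theorem theorem4p3 (R : realType) :
  PU21_over (@O2 R) =
  generated_subgroup
    [set \pi_(PU21 R) (I0 R); \pi_(PU21 R) (R1 R); \pi_(PU21 R) (R2 R);
         \pi_(PU21 R) (R3 R); \pi_(PU21 R) (T R)].
Proof.
apply/seteqP; split=> [_ [A OA <-]|]; last exact: generated_sub_integral.
by have [B /val_inj <-] := integral_generated OA.
Qed.
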